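(* Let $\mu\in{}^*\mathcal D(\mathfrak A)$ and $r\in{}^*[0,\infty)$. Then there is $K_0\in{}^*\mathbb N$ such that for every $K\in{}^*\mathbb N$ with $K\ge K_0$ there is $\lambda\in{}^*\mathcal D(\mathfrak A)$ with $e^{r(\mu\star-1)}\approx\lambda^{K\star}$; moreover one can take \[\lambda=\big(1+rK^{-1}\big)^{-1}\big(\delta_0+rK^{-1}\mu\big).\]
   Context: Setting: $\mathcal L$ a first-order language, $\mathfrak A=(A,\dots)$ an $\mathcal L$-structure (with $\mathcal L$ countable or $\mathrm{Th}(\mathfrak A)$ without the independence property), with an $\mathcal L$-formula $\theta(x,y,z)$ defining a commutative associative total operation $x+y$ with neutral element $0$. $\sigma\mathcal B$ is the $\sigma$-algebra of subsets of a saturated elementary extension of $\mathfrak A$ generated by the sets defined by $\mathcal L_A$-formulas in one variable; $\mathcal D(\mathfrak A)$ is the set of definable probabilities on $\mathfrak A$ (certain $\sigma$-additive probability measures on $\sigma\mathcal B$), containing $\delta_0$ (Dirac at $0$), closed under convex combinations and under an associative convolution $\star$ induced by $+$ that distributes over convex combinations; $\mu^{0\star}=\delta_0$, $\mu^{n\star}$ the $n$-fold convolution. Work in an $\aleph_1$-saturated nonstandard universe in which $\mathfrak A$, $\mathcal D(\mathfrak A)$, $\star$, $\sigma\mathcal B$ are standard. Elements of ${}^*\mathcal D(\mathfrak A)$ are internal finitely additive probabilities on ${}^*\sigma\mathcal B$; $\star$, powers $\nu^{K\star}$ ($K\in{}^*\mathbb N$) and the internal convolution exponential $e^{r(\nu\star-1)}=e^{-r}\sum_{n\in{}^*\mathbb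 N}\frac{r^n}{n!}\nu^{n\star}$ ($r\in{}^*[0,\infty)$) are defined by transfer. For $\nu_1,\nu_2\in{}^*\mathcal D(\mathfrak A)$, $\nu_1\approx\nu_2$ means $\nu_1(X)-\nu_2(X)$ is infinitesimal for all $X\in{}^*\sigma\mathcal B$. *)

(* Defs.v *)
From mathcomp Require Import all_boot all_order all_algebra.
From mathcomp Require Import all_classical all_reals all_analysis.

Set Implicit Arguments.
Unset Strict Implicit.
Unset Printing Implicit Defensive.

Import Order.TTheory GRing.Theory Num.Theory.
Import numFieldNormedType.Exports.

Local Open Scope card_scope.
Local Open Scope classical_set_scope.
Local Open Scope ring_scope.

Record language : Type := Language {
  fsym : Type;
  rsym : Type;
  farity : fsym -> nat;
  rarity : rsym -> nat }.

Inductive term (L : language) (n : nat) : Type :=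
| tvar : 'I_n -> term L n
| tapp : forall f : fsym L, ('I_(farity f) -> term L n) -> term L n.

(** [formula L n]: formulas whose free variables are among [0, ..., n-1];
    [fall] binds variable [0] and shifts the others down by one. *)
Inductive formula (L : language) : nat -> Type :=
| feq : forall n, term L n -> term L n -> formula L n
| frel : forall n (s : rsym L), ('I_(rarity s) -> term L n) -> formula L n
| fbot : forall n, formula L n
| fimp : forall n, formula L n -> formula L n -> formula L n
| fall : forall n, formula L n.+1 -> formula L n.

Record structure (L : language) : Type := Structure {
  dom :> pointedType;
  fint : forall f : fsym L, ('I_(farity f) -> dom) -> dom;
  rint : forall s : rsym L, set ('I_(rarity s) -> dom) }.
Arguments fint {L} s f v : rename.
Arguments rint {L} s r v : rename.

Definition scons (T : Type) (n : nat) (x : T) (v : 'I_n -> T) : 'I_n.+1 -> T :=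
  fun i => oapp v x (unlift ord0 i).

Definition vnil (T : Type) : 'I_0 -> T :=
  fun i => False_rect T (notF (ltn_ord i)).
Arguments vnil {T}.

Definition vec3 (T : Type) (x y z : T) : 'I_3 -> T :=
  scons x (scons y (scons z vnil)).

Fixpoint eval (L : language) (S : structure L) (n : nat) (v : 'I_n -> S)
    (t : term L n) : S :=
  match t with
  | tvar i => v i
  | tapp f a => fint S f (fun i => eval v (a i))
  end.

Fixpoint sat (L : language) (S : structure L) (n : nat) (phi : formula L n) :
    ('I_n -> S) -> Prop :=
  match phi in formula _ n return ('I_n -> S) -> Prop with
  | feq _ s t => fun v => eval v s = eval v t
  | frel _ r a => fun v => rint S r (fun i => eval v (a i))
  | fbot _ => fun _ => False
  | fimp _ p q => fun v => sat p v -> sat q v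
  | fall _ p => fun v => forall x : S, sat p (scons x v)
  end.

Definition elementary (L : language) (A M : structure L) (e : A -> M) : Prop :=
  forall n (phi : formula L n) (v : 'I_n -> A), sat phi v <-> sat phi (e \o v).

Definition countable_language (L : language) : Prop :=
  countable [set: fsym L] /\ countable [set: rsym L].

(** Some formula [phi(x;y)], with [x] and [y] tuples of variables, shatters
    sets of [x]-tuples of every finite size. As this is expressed by first-order
    sentences, it is a property of the complete theory of [A]. *)
Definition independence_property (L : language) (A : structure L) : Prop :=
  exists n k (phi : formula L (n + k)), forall m : nat,
  exists (a : 'I_m -> 'I_n -> A) (b : {set 'I_m} -> 'I_k -> A),
  forall (i : 'I_m) (J : {set 'I_m}),
    sat phi (fun l => match fintype.split l with inl l1 => a i l1 | inr l2 => b J l2 end)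
    <-> i \in J.

(** A formula in one variable (variable [0]) with parameters in [S]. *)
Record pformula (L : language) (S : structure L) : Type := PFormula {
  pnum : nat;
  pform : formula L pnum.+1;
  ppar : 'I_pnum -> S }.
Arguments pform {L S} p : rename.
Arguments ppar {L S} p i : rename.

Section saturation.
Variables (L : language) (S : structure L).
Implicit Types (p q : set (pformula S)).

Definition psat (f : pformula S) (x : S) : Prop :=
  sat (pform f) (scons x (ppar f)).

Definition satisfiable p : Prop := exists x : S, forall f, p f -> psat f x.

Definition finitely_satisfiable p : Prop :=
  forall q, finite_set q -> q `<=` p -> satisfiable q.

(** [~ ([set: S] #<= B)] says that [B] has cardinality less than [S]. *)
Definition saturated : Prop :=
  forall (B : set S) p, ~ ([set: S] #<= B) ->
    (forall f, p f -> forall i, B (ppar f i)) ->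
    finitely_satisfiable p -> satisfiable p.

(** Saturation for countable families of sets definable with parameters. *)
Definition countably_saturated : Prop :=
  forall p, countable p -> finitely_satisfiable p -> satisfiable p.

End saturation.

Section definable_sets.
Variables (L : language) (A M : structure L) (e : A -> M).

(** Subsets of [M] (resp. of [M * M]) defined by formulas with parameters in
    [A], the latter being mapped into [M] by [e]. *)
Definition definable : set (set M) :=
  [set X | exists k (phi : formula L k.+1) (a : 'I_k -> A),
    X = [set x | sat phi (scons x (e \o a))]].

Definition definable2 : set (M -> M -> Prop) :=
  [set E | exists k (phi : formula L k.+2) (a : 'I_k -> A),
    E = (fun x y => sat phi (scons x (scons y (e \o a))))].

Definition sigma_space : measurableType (sigma_display definable) :=
  g_sigma_algebraType definable.

Definition sigmaB : Type := {X : set sigma_space | measurable X}.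

Definition smeasure (R : realType) : Type := {measure set sigma_space -> \bar R}.

End definable_sets.

(** Library measures are set functions on all subsets; two of them are the same
    measure on the sigma-algebra when they agree on the measurable sets. *)
Definition eqm d (T : measurableType d) (R : realType)
    (m1 m2 : {measure set T -> \bar R}) : Prop :=
  forall X, measurable X -> m1 X = m2 X.

Definition mcomb d (T : measurableType d) (R : realType) (a b : {nonneg R})
    (m1 m2 : {measure set T -> \bar R}) : {measure set T -> \bar R} :=
  measure_add (mscale a m1) (mscale b m2).

Section operation.
Variables (L : language) (theta : formula L 3).

Definition add_rel (S : structure L) (x y z : S) : Prop :=
  sat theta (vec3 x y z).

Record defines_comm_monoid (A : structure L) (zero : A) : Prop := {
  add_total : forall x y : A, exists! z, add_rel x y z;
  add_comm : forall x y z : A, add_rel x y z -> add_rel y x z;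
  add_assoc : forall x y z u v w : A,
    add_rel x y u -> add_rel u z w -> add_rel y z v -> add_rel x v w;
  add_zero : forall x : A, add_rel zero x x }.

(** The translate [X - y], that is [{x | x + y \in X}]. *)
Definition translate (S : structure L) (X : set S) (y : S) : set S :=
  [set x | exists2 z, add_rel x y z & X z].

End operation.

Section definable_probabilities.
Variables (R : realType) (L : language) (A M : structure L) (e : A -> M).

(** Finitely additive probability on the subsets of [M] definable with
    parameters in [M]. *)
Record keisler_measure (g : set M -> R) : Prop := {
  keisler_ge0 : forall X, definable (@id M) X -> 0 <= g X;
  keisler_setT : g setT = 1;
  keisler_add : forall X Y, definable (@id M) X -> definable (@id M) Y ->
    X `&` Y = set0 -> g (X `|` Y) = g X + g Y }.

(** [g] extends [mu] to the sets definable over [M], and is itself definable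
    over [A]: the measure of the fibre over [y] of an [A]-definable relation is
    a measurable function of [y]. *)
Record definable_extension (mu : smeasure e R) (g : set M -> R) : Prop := {
  defext_keisler : keisler_measure g;
  defext_extends : forall X, definable e X -> mu X = (g X)%:E;
  defext_definable : forall E, definable2 e E ->
    measurable_fun setT (fun y : sigma_space e => g [set x | E x y]) }.

Variables (theta : formula L 3) (zero : A).

Definition delta0 : smeasure e R := dirac (e zero : sigma_space e).

(** [D], with the convolution [conv], is a class of definable probabilities.
    [D] and [conv] only matter up to [eqm], and [conv] only matters on [D]. *)
Record definable_probabilities (D : set (smeasure e R))
    (conv : smeasure e R -> smeasure e R -> smeasure e R) : Prop := {
  dp_probability : forall mu, D mu -> mu setT = 1%E;
  dp_eqm : forall mu nu, eqm mu nu -> D mu -> D nu;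
  dp_delta0 : D delta0;
  dp_convex : forall (a b : {nonneg R}) mu nu, a%:num + b%:num = 1 ->
    D mu -> D nu -> D (mcomb a b mu nu);
  dp_conv : forall mu nu, D mu -> D nu -> D (conv mu nu);
  dp_conv_eqm : forall mu mu' nu nu', D mu -> D nu ->
    eqm mu mu' -> eqm nu nu' -> eqm (conv mu nu) (conv mu' nu');
  dp_convA : forall mu nu rho, D mu -> D nu -> D rho ->
    eqm (conv mu (conv nu rho)) (conv (conv mu nu) rho);
  dp_convDl : forall (a b : {nonneg R}) mu nu rho, a%:num + b%:num = 1 ->
    D mu -> D nu -> D rho ->
    eqm (conv (mcomb a b mu nu) rho) (mcomb a b (conv mu rho) (conv nu rho));
  dp_convDr : forall (a b : {nonneg R}) mu nu rho, a%:num + b%:num = 1 ->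
    D mu -> D nu -> D rho ->
    eqm (conv rho (mcomb a b mu nu)) (mcomb a b (conv rho mu) (conv rho nu));
  (** [(mu * nu)(X) = \int mu(X - y) dnu(y)], where [mu(X - y)] is computed
      with the definable extension of [mu]. *)
  dp_induced : forall mu, D mu -> exists2 g, definable_extension mu g &
    forall nu X, D nu -> definable e X ->
      conv mu nu X = (\int[nu]_y (g (translate theta X y))%:E)%E }.

Variable conv : smeasure e R -> smeasure e R -> smeasure e R.

Fixpoint conv_pow (nu : smeasure e R) (n : nat) : smeasure e R :=
  if n is n'.+1 then conv (conv_pow nu n') nu else delta0.

(** [e^{-r} \sum_n r^n / n! nu^n] *)
Definition conv_exp (r : {nonneg R}) (nu : smeasure e R) : smeasure e R :=
  mscale (NngNum (expR_ge0 (- r%:num)))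
    (mseries (fun n => mscale (r%:num ^+ n / n`!%:R)%:nng (conv_pow nu n)) 0).

(** [(1 + r/K)^{-1} (delta0 + r/K mu)] *)
Definition conv_root (mu : smeasure e R) (r : {nonneg R}) (K : nat) :
    smeasure e R :=
  mscale ((1 + r%:num / K%:R)^-1)%:nng
    (measure_add delta0 (mscale (r%:num / K%:R)%:nng mu)).

End definable_probabilities.

(** All finitary operations and relations on the standard universe [V] have a
    symbol, so that [elementary] becomes the transfer principle, and the sets
    definable with parameters in the extension are internal. *)
Definition full_language (V : Type) : language := {|
  fsym := {n & ('I_n -> V) -> V};
  rsym := {n & set ('I_n -> V)};
  farity := fun f => projT1 f;
  rarity := fun s => projT1 s |}.

Definition full_structure (V : pointedType) : structure (full_language V) :=
  @Structure (full_language V) V (fun f => projT2 f) (fun s => projT2 s).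

Record nonstandard_universe (V : pointedType) : Type := NonstandardUniverse {
  ns_str :> structure (full_language V);
  ns_star : V -> ns_str;
  ns_transfer : elementary (ns_star : full_structure V -> ns_str);
  ns_saturated : countably_saturated ns_str }.

(** The elements of the type [T] are elements of the standard universe [V]. *)
Class embeds (T : Type) (V : Type) : Type := Embeds {
  inV : T -> V;
  inV_inj : injective inV }.

#[global] Instance embeds_nonneg (R : realType) (V : Type) (i : embeds R V) :
  embeds {nonneg R} V :=
  {| inV := fun r => inV r%:num;
     inV_inj := fun r s h => val_inj (inV_inj h) |}.

Section star.
Variables (V : pointedType) (NS : nonstandard_universe V).

(** Value in [NS] of the transforms of a relation and of an operation of [V]. *)
Definition star_rel n (P : set ('I_n -> V)) : set ('I_n -> NS) :=
  rint NS (existT _ n P : rsym (full_language V)).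

Definition star_fun n (f : ('I_n -> V) -> V) : ('I_n -> NS) -> NS :=
  fint NS (existT _ n f : fsym (full_language V)).

Definition in_range (T : Type) (i : embeds T V) (P : set T) : set ('I_1 -> V) :=
  [set v | exists2 t, P t & v ord0 = inV t].

Definition hyper (T : Type) {i : embeds T V} : Type :=
  {x : NS | star_rel (in_range i setT) (fun=> x)}.
Arguments hyper T {i}.

(** The internal set [*P], for [P] a standard set. *)
Definition hset (T : Type) {i : embeds T V} (P : set T) : set (hyper T) :=
  [set x | star_rel (in_range i P) (fun=> sval x)].

Definition hle {i : embeds nat V} (m n : hyper nat) : Prop :=
  star_rel [set v : 'I_2 -> V | exists a b : nat,
      [/\ v ord0 = inV a, v ord_max = inV b & (a <= b)%N]]
    (scons (sval m) (fun=> sval n)).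

Variables (T1 T2 T3 U : Type).
Context {i1 : embeds T1 V} {i2 : embeds T2 V} {i3 : embeds T3 V}
  {j : embeds U V}.

(** [f] as an operation on [V], with an irrelevant value outside the ranges
    of [T1], [T2], [T3]. *)
Definition raw (f : T1 -> T2 -> T3 -> U) (v : 'I_3 -> V) : V :=
  xget (v ord0) [set w | exists a b c,
    v = vec3 (inV a) (inV b) (inV c) /\ w = inV (f a b c)].

Lemma rawE f a b c : raw f (vec3 (inV a) (inV b) (inV c)) = inV (f a b c).
Proof.
rewrite /raw; case: xgetP => [w -> [a' [b' [c' [+ ->]]]]|/(_ (inV (f a b c)))[]];
  last by exists a, b, c.
move=> E; congr (inV (f _ _ _)); apply: inV_inj.
- by have := congr1 (@^~ ord0) E; rewrite /vec3 /scons !unlift_none.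
- have := congr1 (@^~ (lift ord0 ord0)) E.
  by rewrite /vec3 /scons !liftK /= !unlift_none.
- have := congr1 (@^~ (lift ord0 (lift ord0 ord0))) E.
  by rewrite /vec3 /scons !liftK /= !liftK /= !unlift_none.
Qed.

Lemma star_raw_in (f : T1 -> T2 -> T3 -> U) (x : hyper T1) (y : hyper T2)
    (z : hyper T3) :
  star_rel (in_range j setT)
    (fun=> star_fun (raw f) (vec3 (sval x) (sval y) (sval z))).
Proof.
pose L := full_language V.
pose R1 T (i : embeds T V) : rsym L := existT _ 1%N (in_range i setT).
pose F : fsym L := existT _ 3%N (raw f).
pose x0 : 'I_3 := ord0.
pose x1 : 'I_3 := lift ord0 ord0.
pose x2 : 'I_3 := lift ord0 (lift ord0 ord0).
pose at_ T (i : embeds T V) (t : term L 3) : formula L 3 :=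
  frel (s := R1 T i) (fun=> t).
pose body : formula L 3 :=
  fimp (at_ _ i1 (tvar L x0)) (fimp (at_ _ i2 (tvar L x1))
    (fimp (at_ _ i3 (tvar L x2))
      (at_ _ j (tapp (f := F) (fun i => tvar L i))))).
pose phi : formula L 0 := fall (fall (fall body)).
have e0 T (a b c : T) : vec3 a b c x0 = a.
  by rewrite /vec3 /x0 /scons unlift_none.
have e1 T (a b c : T) : vec3 a b c x1 = b.
  by rewrite /vec3 /x1 /scons liftK /= unlift_none.
have e2 T (a b c : T) : vec3 a b c x2 = c.
  by rewrite /vec3 /x2 /scons liftK /= liftK /= unlift_none.
have phiV : sat phi (vnil : 'I_0 -> full_structure V).
  move=> c b a; change (sat body (vec3 a b c)).
  rewrite /body /= => -[a' _]; rewrite e0 => ->.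
  case=> b' _; rewrite e1 => ->.
  case=> c' _; rewrite e2 => ->.
  by exists (f a' b' c') => //; exact: rawE.
have := (ns_transfer NS phi _).1 phiV.
have -> : ns_star NS \o vnil = vnil by apply/funext => -[].
move=> /(_ (sval z) (sval y) (sval x)) H.
have {H} : sat body (vec3 (sval x) (sval y) (sval z)) by exact: H.
rewrite /body /= e0 e1 e2 => H.
exact: (H (svalP x) (svalP y) (svalP z)).
Qed.

(** The transform [*f] of a standard function [f]. *)
Definition hlift3 (f : T1 -> T2 -> T3 -> U) (x : hyper T1) (y : hyper T2)
    (z : hyper T3) : hyper U :=
  exist _ (star_fun (raw f) (vec3 (sval x) (sval y) (sval z)))
    (star_raw_in f x y z).

End star.

Arguments hyper {V} NS T {i}.
Arguments hset {V NS T i} P.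

(** A binary function is transferred as a ternary one with a dummy argument. *)
Definition hlift2 (V : pointedType) (NS : nonstandard_universe V)
    (T1 T2 U : Type) {i1 : embeds T1 V} {i2 : embeds T2 V} {j : embeds U V}
    (f : T1 -> T2 -> U) (x : hyper NS T1) (y : hyper NS T2) : hyper NS U :=
  hlift3 (fun a b _ => f a b) x y y.

Section infinitely_close.
Variables (V : pointedType) (NS : nonstandard_universe V) (R : realType).
Variables (L : language) (A M : structure L) (e : A -> M).
Context {iR : embeds R V} {iS : embeds (sigmaB e) V}
  {iM : embeds (smeasure e R) V}.

Definition infinitesimal (x : hyper NS R) : Prop :=
  forall eps : R, 0 < eps -> hset [set u : R | `|u| < eps] x.

Definition measure_at (mu : smeasure e R) (X : sigmaB e) : R :=
  fine (mu (sval X)).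

Definition infinitely_close (nu1 nu2 : hyper NS (smeasure e R)) : Prop :=
  forall X : hyper NS (sigmaB e),
    infinitesimal (hlift2 (fun a b : R => a - b)
      (hlift2 measure_at nu1 X) (hlift2 measure_at nu2 X)).

End infinitely_close.

(* Main.v *)
(** With [x = r / K], [lambda] is the mixture of [delta0] and [mu] with weights
    [1 / (1 + x)] and [x / (1 + x)], so that [lambda^K] expands by the binomial
    formula as [(1 + x)^-K * \sum_n 'C(K, n) x^n mu^n].  Its unnormalised
    coefficients satisfy ['C(K, n) x^n <= r^n / n!], hence the total variation
    between the two sides is controlled by the total masses alone, namely by
    [1 - (1 + x)^K e^-r <= r^2 / K].  This holds in the standard universe for all
    [mu], [r] and [K > 0]; by transfer it suffices to take [K0] larger than
    [r^2 (N + 1)] for an infinite hypernatural [N], which exists by saturation.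

    The binomial expansion needs [nu * delta0 = nu]: it follows from the integral
    formula for the convolution on definable sets, and from the uniqueness of
    measures on the generated sigma-algebra. *)
Require Import Defs.
From mathcomp Require Import all_boot all_order all_algebra.
From mathcomp Require Import all_classical all_reals all_analysis.
From mathcomp Require Import ring lra.
From mathcomp Require Import measurable_realfun.

Set Implicit Arguments.
Unset Strict Implicit.
Unset Printing Implicit Defensive.

(* Imported again because mathcomp shadows [frel] and [eval]. *)
Import Defs.
Import Order.TTheory GRing.Theory Num.Theory.
Import numFieldNormedType.Exports.

Local Open Scope classical_set_scope.
Local Open Scope ring_scope.

(** * Tuples of variables and maps between them *)

Lemma scons0 (T : Type) n (x : T) (v : 'I_n -> T) : scons x v ord0 = x.
Proof. by rewrite /scons unlift_none. Qed.

Lemma sconsS (T : Type) n (x : T) (v : 'I_n -> T) i :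
  scons x v (lift ord0 i) = v i.
Proof. by rewrite /scons liftK. Qed.

Definition sconsE := (scons0, sconsS).

Lemma scons_eta (T : Type) n (w : 'I_n.+1 -> T) :
  w = scons (w ord0) (w \o lift ord0).
Proof.
by apply/funext => i; case: (unliftP ord0 i) => [j|] ->; rewrite !sconsE.
Qed.

Lemma comp_scons (T U : Type) n (f : T -> U) (x : T) (v : 'I_n -> T) :
  f \o scons x v = scons (f x) (f \o v).
Proof.
rewrite [LHS]scons_eta /= scons0; congr scons.
by apply/funext => i /=; rewrite sconsS.
Qed.

Lemma vnil_eta (T : Type) (w : 'I_0 -> T) : w = vnil.
Proof. by apply/funext => -[]. Qed.

Lemma comp_vec3 (T U : Type) (f : T -> U) (x y z : T) :
  f \o vec3 x y z = vec3 (f x) (f y) (f z).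
Proof. by rewrite /vec3 !comp_scons [f \o vnil]vnil_eta. Qed.

(** * Renaming of variables in formulas *)

Section renaming.
Variable L : language.

Fixpoint trename n m (s : 'I_n -> 'I_m) (t : term L n) : term L m :=
  match t with
  | tvar i => tvar L (s i)
  | tapp f a => tapp (fun i => trename s (a i))
  end.

Definition slift n m (s : 'I_n -> 'I_m) : 'I_n.+1 -> 'I_m.+1 :=
  scons ord0 (lift ord0 \o s).

Fixpoint frename n (phi : formula L n) : forall m, ('I_n -> 'I_m) -> formula L m :=
  match phi in formula _ n return forall m, ('I_n -> 'I_m) -> formula L m with
  | feq _ t u => fun m s => feq (trename s t) (trename s u)
  | frel _ r a => fun m s => Defs.frel (fun i => trename s (a i))
  | fbot _ => fun m s => fbot L m
  | fimp _ p q => fun m s => fimp (frename p s) (frename q s)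
  | fall _ p => fun m s => fall (frename p (slift s))
  end.

Variable S : structure L.

Lemma eval_trename n m (s : 'I_n -> 'I_m) (v : 'I_m -> S) (t : term L n) :
  eval v (trename s t) = eval (v \o s) t.
Proof.
by elim: t => //= f a IH; congr fint; apply/funext => i; exact: IH.
Qed.

Lemma scons_slift n m (s : 'I_n -> 'I_m) (x : S) (v : 'I_m -> S) :
  scons x v \o slift s = scons x (v \o s).
Proof.
rewrite /slift comp_scons scons0; congr scons.
by apply/funext => i /=; rewrite sconsS.
Qed.

Lemma sat_frename n (phi : formula L n) m (s : 'I_n -> 'I_m) (v : 'I_m -> S) :
  sat (frename phi s) v <-> sat phi (v \o s).
Proof.
elim: phi m s v => [k t u|k r a|k|k p IHp q IHq|k p IH] m s v //=.
- by rewrite !eval_trename.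
- suff -> : (fun i => eval v (trename s (a i))) =
            (fun i => eval (v \o s) (a i)) by [].
  by apply/funext => i; rewrite eval_trename.
- by rewrite IHp IHq.
- by split=> H x; have := H x; rewrite IH scons_slift.
Qed.

End renaming.

(** * Closure properties of definable sets, and the translate by zero *)

Section definable_closure.
Variables (L : language) (A M : structure L) (e : A -> M).

Lemma definable_setT : definable e setT.
Proof.
exists 0, (fimp (fbot L 1) (fbot L 1)), vnil.
apply/esym/seteqP; split => x //=.
Qed.

(** Uniqueness of measures needs a pi-system. The two parameter tuples are concatenated, and
    conjunction is encoded by implication and falsity. *)
Lemma definable_setI : setI_closed (definable e).
Proof.
move=> X Y [k [phi [a ->]]] [l [psi [b ->]]].
pose s1 : 'I_k.+1 -> 'I_(k + l).+1 := scons ord0 (lift ord0 \o lshift l).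
pose s2 : 'I_l.+1 -> 'I_(k + l).+1 := scons ord0 (lift ord0 \o @rshift k l).
pose c (i : 'I_(k + l)) := match fintype.split i with inl j => a j | inr j => b j end.
exists (k + l)%N, (fimp (fimp (frename phi s1) (fimp (frename psi s2) (fbot L _)))
  (fbot L _)), c.
have E1 x : scons x (e \o c) \o s1 = scons x (e \o a).
  rewrite /s1 comp_scons scons0; congr scons; apply/funext => i /=.
  by rewrite sconsS /c /= -[lshift l i]/(unsplit (inl i)) unsplitK.
have E2 x : scons x (e \o c) \o s2 = scons x (e \o b).
  rewrite /s2 comp_scons scons0; congr scons; apply/funext => i /=.
  by rewrite sconsS /c /= -[rshift k i]/(unsplit (inr i)) unsplitK.
apply/seteqP; split=> x /=; rewrite !sat_frename E1 E2.
  by move=> [? ?]; apply.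
by move=> H; split; apply: contrapT => H'; apply: H.
Qed.

Variables (theta : formula L 3).

(** The fibre of this relation over [y] is the translate of [X] by [y], so definability of an
    extension [g] makes [g (translate theta X y)] measurable in [y]. *)
Lemma definable2_translate X : definable e X ->
  definable2 e (fun x y => translate theta X y x).
Proof.
move=> [k [phi [a ->]]].
(* Under the quantifier the variables are [z], [x], [y] and then the parameters; [phi] is evaluated
   at [z]. The existential over [z] becomes a negated universal. *)
pose s : 'I_k.+1 -> 'I_k.+3 :=
  scons ord0 (fun i => lift ord0 (lift ord0 (lift ord0 i))).
pose th := frename theta
  (vec3 (lift ord0 ord0) (lift ord0 (lift ord0 ord0)) ord0 : 'I_3 -> 'I_k.+3).
exists k, (fimp (fall (fimp th (fimp (frename phi s) (fbot L _)))) (fbot L _)), a.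
apply/funext => x; apply/funext => y; apply/propext.
have E z : scons z (scons x (scons y (e \o a))) \o s = scons z (e \o a).
  rewrite /s comp_scons scons0; congr scons.
  by apply/funext => i /=; rewrite !sconsS.
rewrite /translate /= /th; split.
  move=> [z xyz Xz] /(_ z); rewrite !sat_frename comp_vec3 E !sconsE.
  exact.
move=> H; apply: contrapT => H'; apply: H => z.
rewrite !sat_frename comp_vec3 E !sconsE => xyz Xz.
by apply: H'; exists z.
Qed.

End definable_closure.

(** Neutrality of [zero] and uniqueness of sums with it hold in [A]; each is written as a formula
    about [zero] alone, so elementarity carries it to [M]. *)
Lemma translate_zero (L : language) (A M : structure L) (e : A -> M)
    (theta : formula L 3) (zero : A) (X : set M) :
  elementary e -> defines_comm_monoid theta zero ->
  translate theta X (e zero) = X.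
Proof.
move=> eE mon.
have add0 (x : A) : add_rel theta x zero x.
  by apply: (add_comm mon); exact: (add_zero mon).
pose x1 : 'I_3 := lift ord0 ord0; pose x2 : 'I_3 := lift ord0 (lift ord0 ord0).
pose phi : formula L 1 := fall (fall
  (fimp (frename theta (vec3 x1 x2 ord0)) (feq (tvar L x1) (tvar L ord0)))).
pose psi : formula L 1 := fall (fall (frename theta (vec3 x1 x2 x1))).
have satM (f : formula L 1) :
    sat f (scons zero vnil) -> sat f (scons (e zero) vnil).
  by move=> /eE; rewrite comp_scons [e \o vnil]vnil_eta.
have uniqM (x z : M) : add_rel theta x (e zero) z -> x = z.
  have /satM : sat phi (scons zero vnil).
    rewrite /phi /= => u v; rewrite sat_frename comp_vec3 !sconsE => uv.
    have [w [_ uniq_w]] := add_total mon u zero.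
    by rewrite -(uniq_w _ uv) -(uniq_w _ (add0 u)).
  by rewrite /phi /= => /(_ x z); rewrite sat_frename comp_vec3 !sconsE.
have addM0 (x : M) : add_rel theta x (e zero) x.
  have /satM : sat psi (scons zero vnil).
    rewrite /psi /= => u v; rewrite sat_frename comp_vec3 !sconsE.
    exact: add0.
  by rewrite /psi /= => /(_ x x); rewrite sat_frename comp_vec3 !sconsE.
apply/seteqP; split=> x; first by move=> [z /uniqM ->].
by move=> Xx; exists x.
Qed.

(** * Right neutrality of the Dirac mass at zero *)

Section convolution.
Variables (R : realType) (L : language) (A M : structure L) (e : A -> M).
Variables (theta : formula L 3) (zero : A).
Variables (D : set (smeasure e R)).
Variables (conv : smeasure e R -> smeasure e R -> smeasure e R).
Hypotheses (eE : elementary e) (mon : defines_comm_monoid theta zero).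
Hypothesis dD : definable_probabilities theta zero D conv.

Local Notation d0 := (delta0 R e zero).

(** Definable sets form a generating pi-system, and the constant cover by [setT] has finite mass. *)
Lemma eqm_definable (m1 m2 : smeasure e R) : m1 setT = 1%E ->
  (forall X, definable e X -> m1 X = m2 X) -> eqm m1 m2.
Proof.
move=> m1T m12 X mX.
apply: (@measure_unique _ R (sigma_space e) (definable e) (fun=> setT) _ _ _ _ m1 m2) => //.
- exact: definable_setI.
- by move=> _; exact: definable_setT.
- by apply/seteqP; split=> // x _; exists 0%N.
- by move=> _; rewrite m1T ltry.
Qed.

Lemma conv_delta0 nu : D nu -> eqm (conv nu d0) nu.
Proof.
move=> Dnu; apply: eqm_definable.
  exact: (dp_probability dD (dp_conv dD Dnu (dp_delta0 dD))).
move=> X defX; have [g [gK gext gdef]] := dp_induced dD Dnu.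
move=> /(_ _ X (dp_delta0 dD) defX) ->.
(* Integration against a Dirac mass is evaluation at [e zero] once the integrand is measurable,
   which the definability of [g] provides. *)
rewrite /delta0 integral_dirac //; last first.
  apply/measurable_EFinP.
  exact: gdef (definable2_translate theta defX).
by rewrite diracT mul1e (translate_zero X eE mon) gext.
Qed.

End convolution.

(** * Real estimates for binomial and exponential coefficients *)

Section real_bounds.
Variable R : realType.
Implicit Types (r x : R) (K n i j : nat).

Lemma ffact_le_expn n i : (n ^_ i <= n ^ i)%N.
Proof.
elim: i n => [|i IH] [|n]; rewrite ?ffactn0 ?ffact0n ?expn0 //.
rewrite ffactSS expnS leq_mul2l /=; apply: leq_trans (IH n) _.
by case: i {IH} => // i; rewrite leq_exp2r.
Qed.

(** Multiplied by the factorial of [i], the binomial coefficient is the falling factorial [K ^_ i],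
    which is at most [K ^ i]. *)
Lemma bin_term_le r K i : 0 <= r -> (0 < K)%N ->
  'C(K, i)%:R * (r / K%:R) ^+ i <= r ^+ i / i`!%:R.
Proof.
move=> r0 K0.
have f0 : 0 < i`!%:R :> R by rewrite ltr0n fact_gt0.
have k0 : 0 < K%:R ^+ i :> R by rewrite exprn_gt0 // ltr0n.
rewrite ler_pdivlMr // mulrAC -natrM bin_ffact expr_div_n mulrCA.
rewrite ler_piMr ?exprn_ge0 // ler_pdivrMr // mul1r -natrX ler_nat.
exact: ffact_le_expn.
Qed.

(** With [x = r / K], the inequality [expR (x / (1 + x)) <= 1 + x] bounds the right side below by
    [expR (- (K x^2 / (1 + x)))], hence by [1 - K x^2]. *)
Lemma expR_ge_expn r K : 0 <= r -> (0 < K)%N ->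
  1 - r ^+ 2 / K%:R <= (1 + r / K%:R) ^+ K * expR (- r).
Proof.
move=> r0 K0; have k0 : 0 < K%:R :> R by rewrite ltr0n.
have x0 : 0 <= r / K%:R by rewrite divr_ge0 // ltW.
set x := r / K%:R in x0 *.
have x1 : 0 < 1 + x by rewrite ltr_wpDr.
have E1 : expR (x / (1 + x)) <= 1 + x.
  (* This is [1 + y <= expR y] at [y = - (x / (1 + x))], after taking inverses. *)
  rewrite -[leLHS]invrK -expRN -[leRHS]invrK lef_pV2 ?posrE ?expR_gt0 ?invr_gt0 //.
  apply: le_trans (expR_ge1Dx _).
  by rewrite le_eqVlt; apply/orP; left; apply/eqP; field; rewrite gt_eqF.
apply: (@le_trans _ _ (expR (x / (1 + x)) ^+ K * expR (- r))); last first.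
  rewrite ler_wpM2r ?expR_ge0 // lerXn2r ?nnegrE ?expR_ge0 //.
  by rewrite ltW.
rewrite -expRM_natl -expRD.
apply: le_trans (expR_ge1Dx _).
have -> : r = K%:R * x by rewrite /x mulrCA divff ?mulr1 // gt_eqF.
have -> : (K%:R * x) ^+ 2 / K%:R = K%:R * x ^+ 2.
  by field; rewrite gt_eqF.
have -> : K%:R * (x / (1 + x)) + - (K%:R * x) = - (K%:R * x ^+ 2 / (1 + x)).
  by field; rewrite gt_eqF.
rewrite lerD2l lerN2 ler_pdivrMr // ler_peMr ?lerDl //.
by rewrite mulr_ge0 ?exprn_ge0 // ltW.
Qed.

Lemma expn_binE x K : (1 + x) ^+ K = \sum_(i < K.+1) 'C(K, i)%:R * x ^+ i.
Proof.
by rewrite exprDn; apply: eq_bigr => i _; rewrite expr1n mul1r mulr_natl.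
Qed.

(** Binomial coefficients vanish beyond [K], so the finite sum can be compared term by term with
    longer partial sums of the exponential series. *)
Lemma sum_bin_widen x K N (m : nat -> R) : (K < N)%N ->
  \sum_(0 <= i < N) 'C(K, i)%:R * x ^+ i * m i =
  \sum_(i < K.+1) 'C(K, i)%:R * x ^+ i * m i.
Proof.
move=> KN; rewrite (big_cat_nat (n := K.+1)) //= big_mkord.
rewrite [X in _ + X]big_nat_cond [X in _ + X]big1 ?addr0 // => i /andP[/andP[Ki _] _].
by rewrite bin_small // !mul0r.
Qed.

Lemma series_exp_le r N : 0 <= r ->
  \sum_(0 <= i < N) r ^+ i / i`!%:R <= expR r.
Proof.
move=> r0; have := @nondecreasing_cvgn_le R (series (exp_coeff r)).
move=> /(_ _ (is_cvg_series_exp_coeff r) N); apply.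
apply/nondecreasing_seqP => n; rewrite /series /= big_nat_recr //= lerDl.
by rewrite /exp_coeff /= divr_ge0 ?exprn_ge0.
Qed.

Lemma expn_le_expR r K : 0 <= r -> (0 < K)%N -> (1 + r / K%:R) ^+ K <= expR r.
Proof.
move=> r0 K0; rewrite expn_binE; apply: le_trans (series_exp_le K.+1 r0).
by rewrite big_mkord; apply: ler_sum => i _; exact: bin_term_le.
Qed.

(** The lower bound compares [B] with the first [K.+1] terms of a nonnegative series. For the upper
    one, [m i <= 1] bounds the excess of a partial sum over [B] by the sum of the gaps between
    coefficients. *)
Lemma sum_exp_bin_bounds r K (m : nat -> R) (E : \bar R) :
  0 <= r -> (0 < K)%N -> (forall i, 0 <= m i <= 1) ->
  E = (\sum_(0 <= i <oo) (r ^+ i / i`!%:R * m i)%:E)%E ->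
  let B := \sum_(i < K.+1) 'C(K, i)%:R * (r / K%:R) ^+ i * m i in
  (B%:E <= E <= (B + (expR r - (1 + r / K%:R) ^+ K))%:E)%E.
Proof.
move=> r0 K0 m01 ->; set B := \sum_(i < K.+1) _ => /=; pose t i := r ^+ i / i`!%:R.
pose b i := 'C(K, i)%:R * (r / K%:R) ^+ i.
have m0 i : 0 <= m i by case/andP: (m01 i).
have m1 i : m i <= 1 by case/andP: (m01 i).
have t0 i : 0 <= t i by rewrite divr_ge0 ?exprn_ge0.
have tm0 i : (0 <= (t i * m i)%:E)%E by rewrite lee_fin mulr_ge0.
have bt i : b i <= t i by exact: bin_term_le.
apply/andP; split.
  apply: le_trans (nneseries_lim_ge K.+1 _); last by move=> i _ _; exact: tm0.
  rewrite sumEFin lee_fin big_mkord; apply: ler_sum => i _.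
  by rewrite ler_wpM2r ?m0 ?bt.
apply: lime_le; first by apply: is_cvg_nneseries => i _ _; exact: tm0.
near=> N; have KN : (K < N)%N by near: N; exact: nbhs_infty_gt.
rewrite sumEFin lee_fin -lerBlDl /B -(sum_bin_widen _ _ KN) -sumrB.
apply: (@le_trans _ _ (\sum_(0 <= i < N) (t i - b i))).
  by apply: ler_sum => i _; rewrite -mulrBl ler_piMr ?m1 ?subr_ge0 ?bt.
rewrite sumrB lerB ?series_exp_le // expn_binE.
have := sum_bin_widen (r / K%:R) (fun=> 1) KN.
under eq_bigr do rewrite mulr1.
by under [in RHS]eq_bigr do rewrite mulr1; move=> ->.
Unshelve. all: by end_near. Qed.

(* With [c] the [K]-th power of [1 + r / K], both [expR (- r) * (E - B)] and
   [(c^-1 - expR (- r)) * B] lie between [0] and [1 - c * expR (- r)]. *)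
Lemma exp_root_bound r K (m : nat -> R) :
  0 <= r -> (0 < K)%N -> (forall i, 0 <= m i <= 1) ->
  `|fine ((expR (- r))%:E * \sum_(0 <= i <oo) (r ^+ i / i`!%:R * m i)%:E)%E -
    (1 + r / K%:R)^-1 ^+ K * \sum_(i < K.+1) 'C(K, i)%:R * (r / K%:R) ^+ i * m i|
  <= r ^+ 2 / K%:R.
Proof.
move=> r0 K0 m01.
have := sum_exp_bin_bounds r0 K0 m01 erefl.
set E := (\sum_(0 <= i <oo) _)%E; set B := \sum_(i < K.+1) _ => /=.
set c := (1 + r / K%:R) ^+ K => /andP[BE EB].
have c0 : 0 < c by rewrite exprn_gt0 // ltr_wpDr // divr_ge0.
have B0 : 0 <= B.
  apply: sumr_ge0 => i _; case/andP: (m01 i) => m0 _.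
  by rewrite mulr_ge0 // mulr_ge0 // exprn_ge0 // divr_ge0.
have Bc : B <= c.
  rewrite /c expn_binE; apply: ler_sum => i _; case/andP: (m01 i) => _ m1.
  by rewrite ler_piMr // mulr_ge0 // exprn_ge0 // divr_ge0.
have ce := expn_le_expR r0 K0; have cr := expR_ge_expn r0 K0.
rewrite -/c in ce cr.
have Efin : E \is a fin_num.
  by rewrite fin_numElt (lt_le_trans (ltNyr _) BE) (le_lt_trans EB (ltry _)).
move: BE EB; rewrite -[E]fineK //= !lee_fin => BE EB.
rewrite exprVn -/c; set x := fine E in BE EB *.
move: cr ce; rewrite expRN; set y := expR r => cr ce.
have y0 : 0 < y by exact: expR_gt0.
apply: (@le_trans _ _ (1 - c * y^-1)); last by rewrite lerBlDr addrC -lerBlDr.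
have H1 : 0 <= y^-1 * (x - B) <= 1 - c * y^-1.
  rewrite mulr_ge0 ?invr_ge0 ?subr_ge0 ?(ltW y0) //=.
  apply: (@le_trans _ _ (y^-1 * (y - c))).
    by rewrite ler_wpM2l ?invr_ge0 ?(ltW y0) // lerBlDl.
  by rewrite mulrBr mulVf ?gt_eqF // mulrC.
have H2 : 0 <= (c^-1 - y^-1) * B <= 1 - c * y^-1.
  have cy : 0 <= c^-1 - y^-1 by rewrite subr_ge0 lef_pV2.
  rewrite mulr_ge0 //=; apply: (@le_trans _ _ ((c^-1 - y^-1) * c)).
    by rewrite ler_wpM2l.
  by rewrite mulrBl mulVf ?gt_eqF // mulrC.
have -> : y^-1 * x - c^-1 * B = y^-1 * (x - B) - (c^-1 - y^-1) * B by ring.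
by rewrite ler_norml; move: H1 H2 => /andP[? ?] /andP[? ?]; apply/andP; split; lra.
Qed.

(** With [S] the shift in [j], the hypothesis says that row [n.+1] is [a + b S] applied to row [n];
    this is the binomial theorem for the powers of [a + b S]. *)
Lemma binomial_recurrence (a b : R) (W : nat -> nat -> R) :
  (forall n j, W n.+1 j = a * W n j + b * W n j.+1) ->
  forall n j, W n j =
    \sum_(i < n.+1) 'C(n, i)%:R * a ^+ (n - i) * b ^+ i * W 0%N (i + j)%N.
Proof.
move=> WS; elim=> [|n IH] j.
  by rewrite big_ord_recl big_ord0 addr0 bin0 !expr0 !mul1r.
rewrite WS !IH big_ord_recl [in RHS]big_ord_recl /= !bin0 !subn0 !expr0 !mulr1 !mul1r.
rewrite mulrDr -addrA mulrA exprS; congr (_ + _).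
(* Pascal's rule splits each coefficient: the first summand comes from the [a] part, the second from
   the [b] part. *)
transitivity (\sum_(i < n.+1)
   ('C(n, i.+1)%:R * a ^+ (n - i) * b ^+ i.+1 * W 0%N (i.+1 + j)%N
   + 'C(n, i)%:R * a ^+ (n - i) * b ^+ i.+1 * W 0%N (i.+1 + j)%N)); last first.
  apply: eq_bigr => i _; rewrite /bump /= add1n binS natrD subSS.
  ring.
rewrite big_split /=; congr (_ + _).
  rewrite [in RHS]big_ord_recr /= bin_small // !mul0r addr0 mulr_sumr.
  apply: eq_bigr => i _; rewrite /bump /= add1n.
  rewrite -(subnSK (ltn_ord i)) (exprS a); ring.
rewrite mulr_sumr; apply: eq_bigr => i _.
rewrite (exprS b) addnS addSn; ring.
Qed.

End real_bounds.

(** * Powers of a mixture and their distance to the convolution exponential *)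

Section convolution_root.
Variables (R : realType) (L : language) (A M : structure L) (e : A -> M).
Variables (theta : formula L 3) (zero : A).
Variables (D : set (smeasure e R)).
Variables (conv : smeasure e R -> smeasure e R -> smeasure e R).
Hypotheses (eE : elementary e) (mon : defines_comm_monoid theta zero).
Hypothesis dD : definable_probabilities theta zero D conv.

Local Notation d0 := (delta0 R e zero).
Local Notation pow := (conv_pow zero conv).

Lemma eqm_sym (m1 m2 : smeasure e R) : eqm m1 m2 -> eqm m2 m1.
Proof. by move=> m12 X mX; rewrite m12. Qed.

Lemma eqm_trans (m1 m2 m3 : smeasure e R) : eqm m1 m2 -> eqm m2 m3 -> eqm m1 m3.
Proof. by move=> m12 m23 X mX; rewrite m12 // m23. Qed.

Lemma mcombE (a b : {nonneg R}) (m1 m2 : smeasure e R) X :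
  mcomb a b m1 m2 X = (a%:num%:E * m1 X + b%:num%:E * m2 X)%E.
Proof. exact: measure_addE. Qed.

Lemma mcomb_eqm (a b : {nonneg R}) (m1 m2 m1' m2' : smeasure e R) :
  eqm m1 m1' -> eqm m2 m2' -> eqm (mcomb a b m1 m2) (mcomb a b m1' m2').
Proof. by move=> m1E m2E X mX; rewrite !mcombE m1E // m2E. Qed.

Lemma D_conv_pow nu n : D nu -> D (pow nu n).
Proof.
move=> Dnu; elim: n => [|n IH] /=; first exact: (dp_delta0 dD).
exact: (dp_conv dD).
Qed.

Lemma D_fin_num nu X : D nu -> measurable X -> nu X \is a fin_num.
Proof.
move=> Dnu mX; rewrite ge0_fin_numE //.
apply: (@le_lt_trans _ _ (nu setT)); last by rewrite (dp_probability dD Dnu) ltry.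
by apply: le_measure; rewrite ?inE.
Qed.

Lemma D_fine01 nu X : D nu -> measurable X -> 0 <= fine (nu X) <= 1.
Proof.
move=> Dnu mX; rewrite fine_ge0 //= -lee_fin fineK ?D_fin_num //.
by rewrite -(dp_probability dD Dnu); apply: le_measure; rewrite ?inE.
Qed.

Variables (mu : smeasure e R) (Dmu : D mu).

(* The powers of a mixture [lam] of [delta0] and [mu] obey the recurrence
   [rconv j (lam^n.+1) = a (rconv j lam^n) + b (rconv j.+1 lam^n)], which needs
   neither commutativity nor [conv delta0 nu = nu]. *)
Definition rconv j (nu : smeasure e R) := iter j (fun rho => conv rho mu) nu.

Lemma D_rconv j nu : D nu -> D (rconv j nu).
Proof. by move=> Dnu; elim: j => //= j IH; exact: (dp_conv dD). Qed.

Lemma rconv_eqm j nu nu' : D nu -> eqm nu nu' -> eqm (rconv j nu) (rconv j nu').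
Proof.
move=> Dnu E; elim: j => //= j IH.
by apply: (dp_conv_eqm dD) => //; exact: D_rconv.
Qed.

Lemma rconv_mcomb (a b : {nonneg R}) j nu rho : a%:num + b%:num = 1 ->
  D nu -> D rho ->
  eqm (rconv j (mcomb a b nu rho)) (mcomb a b (rconv j nu) (rconv j rho)).
Proof.
move=> ab Dnu Drho; elim: j => //= j IH.
have Dc : D (rconv j (mcomb a b nu rho)) by apply: D_rconv; exact: (dp_convex dD).
apply: eqm_trans (dp_conv_eqm dD Dc Dmu IH _) _ => //.
by apply: (dp_convDl dD) => //; exact: D_rconv.
Qed.

Lemma rconv_delta0 j : rconv j d0 = pow mu j.
Proof. by elim: j => [|j IH] //=; rewrite -IH. Qed.

Section mixture_power.
Variables (a b : {nonneg R}) (lam : smeasure e R).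
Hypotheses (ab : a%:num + b%:num = 1) (lamE : eqm lam (mcomb a b d0 mu)).

Lemma D_mixture : D lam.
Proof.
apply: (dp_eqm dD (eqm_sym lamE)).
exact: (dp_convex dD ab (dp_delta0 dD) Dmu).
Qed.

(** One step of the recurrence: right distributivity splits [lam], and [conv_delta0] absorbs the
    Dirac part. *)
Lemma conv_mixture nu : D nu -> eqm (conv nu lam) (mcomb a b nu (conv nu mu)).
Proof.
move=> Dnu; apply: eqm_trans (dp_conv_eqm dD Dnu D_mixture (fun _ _ => erefl) lamE) _.
apply: eqm_trans (dp_convDr dD ab (dp_delta0 dD) Dmu Dnu) _.
by apply: mcomb_eqm; first exact: (conv_delta0 eE mon dD).
Qed.

(** The recurrence for the values at [X] is solved at [j = 0]; by [rconv_delta0] its initial row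
    consists of the powers of [mu]. *)
Lemma conv_pow_mixture n X : measurable X ->
  fine (pow lam n X) = \sum_(i < n.+1)
    'C(n, i)%:R * a%:num ^+ (n - i) * b%:num ^+ i * fine (pow mu i X).
Proof.
move=> mX; pose W k j := fine (rconv j (pow lam k) X).
have WS k j : W k.+1 j = a%:num * W k j + b%:num * W k j.+1.
  have Dk : D (pow lam k) by exact: D_conv_pow D_mixture.
  have DSk : D (conv (pow lam k) mu) by exact: (dp_conv dD).
  rewrite /W -[pow lam k.+1]/(conv (pow lam k) lam).
  rewrite (rconv_eqm j (dp_conv dD Dk D_mixture) (conv_mixture Dk)) //.
  rewrite (rconv_mcomb j ab) // mcombE -[rconv j (conv _ _)]iterSr -/(rconv j.+1 _).
  have fk i : rconv i (pow lam k) X \is a fin_num by exact: D_fin_num (D_rconv _ _) _.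
  by rewrite fineD ?fin_numM ?fk // !fineM ?fk.
rewrite -[LHS]/(W n 0%N) (binomial_recurrence WS).
by apply: eq_bigr => i _; rewrite addn0 /W rconv_delta0.
Qed.

End mixture_power.

Variable r : {nonneg R}.
Local Notation root := (conv_root zero mu r).

(** At [K = 0] division by zero gives [x = 0] and the root is [delta0], so [D_conv_root] holds for
    every [K]. *)
Lemma conv_rootE K (x := r%:num / K%:R) :
  exists a b : {nonneg R}, [/\ a%:num = (1 + x)^-1, b%:num = x / (1 + x),
    a%:num + b%:num = 1 & eqm (root K) (mcomb a b d0 mu)].
Proof.
have x0 : 0 <= x by rewrite divr_ge0.
have a0 : 0 <= (1 + x)^-1 by rewrite invr_ge0 addr_ge0.
have b0 : 0 <= x / (1 + x) by rewrite divr_ge0 // addr_ge0.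
exists (NngNum a0), (NngNum b0); split=> //=.
  by rewrite -[X in X + _]mul1r -mulrDl mulfV // gt_eqF // ltr_wpDr.
move=> X mX.
have -> : root K X = (((1 + x)^-1)%:E * (d0 X + x%:E * mu X))%E.
  by congr (_ * _)%E; exact: measure_addE.
rewrite mcombE ge0_muleDr ?mule_ge0 //.
by congr (_ + _)%E; rewrite muleA -[(_ * x%:E)%E]EFinM [_^-1 * x]mulrC.
Qed.

Lemma D_conv_root K : D (root K).
Proof.
have [a [b [aE bE ab rE]]] := conv_rootE K.
exact: D_mixture ab rE.
Qed.

Lemma conv_exp_root_bound K X : (0 < K)%N -> measurable X ->
  `|fine (conv_exp zero conv r mu X) - fine (pow (root K) K X)|
    <= r%:num ^+ 2 / K%:R.
Proof.
move=> K0 mX; have [a [b [aE bE ab rE]]] := conv_rootE K.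
have m01 i : 0 <= fine (pow mu i X) <= 1 by exact: D_fine01 (D_conv_pow i Dmu) mX.
have -> : conv_exp zero conv r mu X = ((expR (- r%:num))%:E *
    \sum_(0 <= i <oo) (r%:num ^+ i / i`!%:R * fine (pow mu i X))%:E)%E.
  congr (_ * _)%E; apply: eq_eseriesr => i _.
  by rewrite EFinM fineK // D_fin_num //; exact: D_conv_pow.
have -> : fine (pow (root K) K X) = (1 + r%:num / K%:R)^-1 ^+ K *
    \sum_(i < K.+1) 'C(K, i)%:R * (r%:num / K%:R) ^+ i * fine (pow mu i X).
  rewrite (conv_pow_mixture ab rE) // mulr_sumr; apply: eq_bigr => i _.
  rewrite aE bE [(_ / (1 + _)) ^+ _]exprMn.
  (* The [K]-th power of [(1 + x)^-1] is shared out: exponent [K - i] from the weight [a], and [i]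
     from the weight [b]. *)
  have expK (y : R) : y ^+ K = y ^+ (K - i) * y ^+ i.
    by rewrite -exprD subnK // leq_ord.
  by rewrite expK; ring.
exact: exp_root_bound.
Qed.

End convolution_root.

(** * Transfer for formulas with internal arguments *)

Section transfer.
Variables (V : pointedType) (NS : nonstandard_universe V).
Local Notation LV := (full_language V).

(** [ns_transfer] speaks of tuples of standard elements only; the universal closure is a sentence,
    and its transfer can be instantiated anywhere in [NS]. *)
Lemma transfer_valid n (phi : formula LV n) :
  (forall v : 'I_n -> full_structure V, sat phi v) ->
  forall w : 'I_n -> NS, sat phi w.
Proof.
elim: n phi => [|n IH] phi H w.
  have := (ns_transfer NS phi vnil).1 (H vnil).
  by rewrite [ns_star NS \o vnil]vnil_eta [w]vnil_eta.
rewrite [w]scons_eta.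
apply: (IH (fall phi) _ (w \o lift ord0)) => v x.
exact: H.
Qed.

(** An atomic formula with two readings, given by the next two lemmas: membership in [P] in the
    standard universe, and in [hset P] in the extension. The lifted terms and [le_formula] below
    follow the same pattern. *)
Definition in_formula n (T : Type) {i : embeds T V} (P : set T) (t : term LV n) :
    formula LV n :=
  frel (s := existT _ 1%N (in_range i P) : rsym LV) (fun=> t).

Lemma sat_in_formula n (T : Type) {i : embeds T V} (P : set T) (t : term LV n)
    (w : 'I_n -> NS) (x : hyper NS T) :
  eval w t = sval x -> sat (in_formula P t) w <-> hset P x.
Proof. by move=> tx; rewrite /hset /= -tx. Qed.

Lemma sat_in_formulaV n (T : Type) {i : embeds T V} (P : set T) (t : term LV n)
    (v : 'I_n -> full_structure V) :
  sat (in_formula P t) v <-> exists2 a, P a & eval v t = inV a.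
Proof. by []. Qed.

Section lifted_functions.
Variables (T1 T2 T3 U : Type).
Context {i1 : embeds T1 V} {i2 : embeds T2 V} {i3 : embeds T3 V}
  {j : embeds U V}.

Definition lift_term3 n (f : T1 -> T2 -> T3 -> U) (t u s : term LV n) :
    term LV n :=
  tapp (f := existT _ 3%N (raw f) : fsym LV) (vec3 t u s).

Lemma eval_lift_term3 n f (t u s : term LV n) (w : 'I_n -> NS) x y z :
  eval w t = sval x -> eval w u = sval y -> eval w s = sval z ->
  eval w (lift_term3 f t u s) = sval (hlift3 f x y z).
Proof. by move=> tx uy sz; rewrite /= -tx -uy -sz /star_fun -comp_vec3. Qed.

Lemma eval_lift_term3V n f (t u s : term LV n) (v : 'I_n -> full_structure V)
    a b c :
  eval v t = inV a -> eval v u = inV b -> eval v s = inV c ->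
  eval v (lift_term3 f t u s) = inV (f a b c).
Proof. by move=> ta ub sc; rewrite -rawE -ta -ub -sc -comp_vec3. Qed.

End lifted_functions.

Definition lift_term2 n (T1 T2 U : Type) {i1 : embeds T1 V} {i2 : embeds T2 V}
    {j : embeds U V} (f : T1 -> T2 -> U) (t u : term LV n) : term LV n :=
  lift_term3 (fun a b (_ : T2) => f a b) t u u.

Lemma eval_lift_term2 n (T1 T2 U : Type) {i1 : embeds T1 V} {i2 : embeds T2 V}
    {j : embeds U V} (f : T1 -> T2 -> U) (t u : term LV n) (w : 'I_n -> NS) x y :
  eval w t = sval x -> eval w u = sval y ->
  eval w (lift_term2 f t u) = sval (hlift2 f x y).
Proof. by move=> tx uy; exact: (eval_lift_term3 _ tx uy uy). Qed.

Lemma eval_lift_term2V n (T1 T2 U : Type) {i1 : embeds T1 V} {i2 : embeds T2 V}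
    {j : embeds U V} (f : T1 -> T2 -> U) (t u : term LV n)
    (v : 'I_n -> full_structure V) a b :
  eval v t = inV a -> eval v u = inV b ->
  eval v (lift_term2 f t u) = inV (f a b).
Proof. by move=> ta ub; rewrite /lift_term2 (eval_lift_term3V _ ta ub ub). Qed.

Definition le_formula n {i : embeds nat V} (t u : term LV n) : formula LV n :=
  frel (s := existT _ 2%N [set v : 'I_2 -> V | exists a b : nat,
      [/\ v ord0 = inV a, v ord_max = inV b & (a <= b)%N]] : rsym LV)
    (scons t (fun=> u)).

Lemma sat_le_formula n {i : embeds nat V} (t u : term LV n) (w : 'I_n -> NS)
    (k l : hyper NS nat) :
  eval w t = sval k -> eval w u = sval l ->
  sat (le_formula t u) w <-> hle k l.
Proof.
move=> tk ul; rewrite /hle -tk -ul /star_rel /=.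
suff -> : (fun j : 'I_2 => eval w (scons t (fun=> u) j)) =
    scons (eval w t) (fun=> eval w u) by [].
exact: comp_scons.
Qed.

Lemma sat_le_formulaV n {i : embeds nat V} (t u : term LV n)
    (v : 'I_n -> full_structure V) :
  sat (le_formula t u) v <->
  exists a b : nat, [/\ eval v t = inV a, eval v u = inV b & (a <= b)%N].
Proof.
by rewrite /= (_ : ord_max = lift ord0 ord0) ?sconsE //; exact: val_inj.
Qed.

(** Saturation is applied to the countably many conditions [k <= n]; finitely many of them are met
    by the maximum of their bounds. *)
Lemma infinite_hypernatural {i : embeds nat V} :
  exists N : hyper NS nat, forall k : nat, hset [set n | (k <= n)%N] N.
Proof.
pose (p k := PFormula (in_formula [set n | (k <= n)%N]
  (tvar LV (ord0 : 'I_1))) vnil : pformula NS).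
have psatE k x : psat (p k) x <-> star_rel (in_range i [set n | (k <= n)%N]) (fun=> x).
  by rewrite /psat /= scons0.
have star_ge k l : (k <= l)%N ->
    star_rel (in_range i [set n | (k <= n)%N]) (fun=> ns_star NS (inV l)).
  move=> kl.
  have := ns_transfer NS (in_formula [set n | (k <= n)%N]
    (tvar LV (ord0 : 'I_1))) (fun=> inV l).
  by move=> [+ _]; apply; exists l.
have [|q qfin qp|x px] := ns_saturated (p := range p).
- exact: card_image_le.
(* [g] picks an index for each formula of [q], so that finiteness of [q] bounds the indices. *)
- have [g gE] : exists g : pformula NS -> nat, forall f, q f -> p (g f) = f.
    exists (fun f => xget 0%N [set k | p k = f]) => f /qp[k _ pkf].
    by apply: (@xgetPex _ _ [set k | p k = f]); exists k.
  have [s sE] := (finite_seqP _).1 (finite_image g qfin).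
  exists (ns_star NS (inV (\max_(k <- s) k)%N)) => f qf.
  rewrite -(gE f qf); apply/psatE; apply: star_ge.
  apply: (@leq_bigmax_seq _ s xpredT id (g f)) => //.
  by have : (g @` q) (g f) by [exists f]; rewrite sE.
have pxk k : star_rel (in_range i [set n | (k <= n)%N]) (fun=> x).
  by apply/psatE; apply: px; exists k.
(* The condition for [k = 0] already says that [x] is a hypernatural. *)
have x0 : star_rel (in_range i setT) (fun=> x).
  have := pxk 0%N; suff -> : [set n | (0 <= n)%N] = setT by [].
  by apply/seteqP; split.
by exists (exist _ x x0).
Qed.

End transfer.

Theorem theorem4p12 (R : realType) (L : language) (A M : structure L)
    (e : A -> M) (e_elementary : elementary e) (M_saturated : saturated M)
    (L_or_NIP : countable_language L \/ ~ independence_property A)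
    (theta : formula L 3) (zero : A)
    (theta_monoid : defines_comm_monoid theta zero)
    (D : set (smeasure e R))
    (conv : smeasure e R -> smeasure e R -> smeasure e R)
    (D_definable : definable_probabilities theta zero D conv)
    (V : pointedType) (iN : embeds nat V) (iR : embeds R V)
    (iS : embeds (sigmaB e) V) (iM : embeds (smeasure e R) V)
    (NS : nonstandard_universe V)
    (mu : hyper NS (smeasure e R)) (r : hyper NS {nonneg R}) :
  hset D mu ->
  exists K0 : hyper NS nat, forall K : hyper NS nat, hle K0 K ->
    exists lambda : hyper NS (smeasure e R),
      [/\ hset D lambda,
          infinitely_close (hlift2 (conv_exp zero conv) r mu)
            (hlift2 (conv_pow zero conv) lambda K)
        & lambda = hlift3 (conv_root zero) mu r K].
Proof.
move=> Dmu.
(* [F s n] exceeds [s^2 (n + 1)], so every [K >= F s n] is positive and makes the error [s^2 / K]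
   less than [1 / (n + 1)]. *)
pose F (s : {nonneg R}) (n : nat) := (Num.truncn (s%:num ^+ 2 * n.+1%:R)).+1.
have FE s n K eps (X : sigmaB e) nu : D nu -> (F s n <= K)%N ->
    n.+1%:R^-1 < eps ->
    `|measure_at (conv_exp zero conv s nu) X -
      measure_at (conv_pow zero conv (conv_root zero nu s K) K) X| < eps.
  move=> Dnu FK neps.
  have K0 : (0 < K)%N by exact: leq_trans FK.
  apply: le_lt_trans (conv_exp_root_bound e_elementary theta_monoid D_definable
    Dnu s K0 (svalP X)) _.
  apply: lt_trans neps.
  rewrite ltr_pdivrMr ?ltr0n // mulrC ltr_pdivlMr ?ltr0n //.
  by rewrite -truncn_lt_nat // mulr_ge0.
(* At an infinite [N] the error [1 / (N + 1)] is below every standard [eps], so the lift of [F] at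
   [r] and [N] serves as [K0]. *)
have [N NE] := @infinite_hypernatural V NS iN.
exists (hlift2 F r N) => K F_K; exists (hlift3 (conv_root zero) mu r K).
pose LV := full_language V.
pose x0 : term LV 5 := tvar LV ord0.
pose x1 : term LV 5 := tvar LV (lift ord0 ord0).
pose x2 : term LV 5 := tvar LV (lift ord0 (lift ord0 ord0)).
pose x3 : term LV 5 := tvar LV (lift ord0 (lift ord0 (lift ord0 ord0))).
pose x4 : term LV 5 := tvar LV (lift ord0 (lift ord0 (lift ord0 (lift ord0 ord0)))).
(* The five variables stand for [mu], [r], [K], [N] and [X], in this order. *)
pose w (X : NS) : 'I_5 -> NS :=
  scons (sval mu) (scons (sval r) (scons (sval K) (scons (sval N) (scons X vnil)))).
have w0 X : eval (w X) x0 = sval mu by rewrite /= /w !sconsE.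
have w1 X : eval (w X) x1 = sval r by rewrite /= /w !sconsE.
have w2 X : eval (w X) x2 = sval K by rewrite /= /w !sconsE.
have w3 X : eval (w X) x3 = sval N by rewrite /= /w !sconsE.
have w4 X : eval (w X) x4 = X by rewrite /= /w !sconsE.
(* The parenthesised [pose] resolves the instances of [embeds], which the
   ssreflect one would abstract over. *)
pose (root := lift_term3 (conv_root (R := R) (e := e) zero) x0 x1 x2 : term LV 5).
have rootE X : eval (w X) root = sval (hlift3 (conv_root zero) mu r K).
  exact: eval_lift_term3.
split=> //.
  pose (phi := fimp (in_formula D x0)
    (fimp (in_formula (T := {nonneg R}) setT x1)
    (fimp (in_formula (T := nat) setT x2) (in_formula D root))) : formula LV 5).
  have phiV (v : 'I_5 -> full_structure V) : sat phi v.
    move=> /sat_in_formulaV[nu Dnu v0] /sat_in_formulaV[s _ v1].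
    move=> /sat_in_formulaV[k _ v2].
    apply/sat_in_formulaV; exists (conv_root zero nu s k).
      exact: (D_conv_root D_definable Dnu s k).
    exact: eval_lift_term3V.
  (* [phi] speaks of [x0], [x1] and [x2] only; [sval mu] is a dummy value in the slot of [X]. *)
  apply/(sat_in_formula D (rootE (sval mu))).
  apply: (transfer_valid phiV (w (sval mu))).
  - by apply/(sat_in_formula _ (w0 _)).
  - by apply/(sat_in_formula _ (w1 _)); exact: (svalP r).
  - by apply/(sat_in_formula _ (w2 _)); exact: (svalP K).
move=> X eps eps0.
have [n neps] : exists n : nat, n.+1%:R^-1 < eps.
  exists (Num.truncn eps^-1).
  rewrite -[ltRHS]invrK ltf_pV2 ?posrE ?invr_gt0 ?ltr0n //.
  by rewrite -truncn_lt_nat // invr_ge0 ltW.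
(* For standard [eps] and [n], both built into relation symbols, this is the estimate [FE] for all
   [m >= n]; the infinite [N] takes the place of [m]. *)
pose (psi := fimp (in_formula D x0)
  (fimp (in_formula (T := {nonneg R}) setT x1)
  (fimp (in_formula [set m : nat | (n <= m)%N] x3)
  (fimp (le_formula (lift_term2 F x1 x3) x2)
  (fimp (in_formula (T := sigmaB e) setT x4)
    (in_formula [set u : R | `|u| < eps]
      (lift_term2 (fun a b : R => a - b)
        (lift_term2 (@measure_at R L A M e)
          (lift_term2 (conv_exp zero conv) x1 x0) x4)
        (lift_term2 (@measure_at R L A M e)
          (lift_term2 (conv_pow zero conv) root x2) x4))))))) : formula LV 5).
have psiV (v : 'I_5 -> full_structure V) : sat psi v.
  move=> /sat_in_formulaV[nu Dnu v0] /sat_in_formulaV[s _ v1].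
  move=> /sat_in_formulaV[m nm v3] /sat_le_formulaV[a [k [vF v2 ak]]].
  move=> /sat_in_formulaV[Y _ v4].
  (* The order relation supplies only some [a] coded by the value of the term; injectivity of the
     coding identifies it. *)
  have aE : a = F s m.
    by apply: inV_inj; rewrite -vF; exact: eval_lift_term2V.
  apply/sat_in_formulaV.
  exists (measure_at (conv_exp zero conv s nu) Y -
    measure_at (conv_pow zero conv (conv_root zero nu s k) k) Y).
    apply: (FE _ m) => //; first by rewrite -aE.
    apply: le_lt_trans neps; rewrite lef_pV2 ?posrE ?ltr0n // ler_nat ltnS.
    exact: nm.
  have vroot : eval v root = inV (conv_root zero nu s k) by exact: eval_lift_term3V.
  apply: eval_lift_term2V; apply: eval_lift_term2V => //; exact: eval_lift_term2V.
have := transfer_valid psiV (w (sval X)).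
move=> /(_ ((sat_in_formula D (w0 _)).2 Dmu)).
move=> /(_ ((sat_in_formula setT (w1 _)).2 (svalP r))).
move=> /(_ ((sat_in_formula _ (w3 _)).2 (NE n))).
move=> /(_ ((sat_le_formula (eval_lift_term2 F (w1 _) (w3 _)) (w2 _)).2 F_K)).
move=> /(_ ((sat_in_formula setT (w4 _ : _ = sval X)).2 (svalP X))).
apply: (sat_in_formula _ _).1.
apply: eval_lift_term2; apply: eval_lift_term2 => //; apply: eval_lift_term2 => //.
Qed.
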